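(* Let $(N,E)$ be a network satisfying the standing assumptions. A rule $\phi$ satisfies efficient implementation, realized-loss dependence, pairwise collusion-proofness, and scale invariance if and only if $\phi=\phi^w$ for some $w\in\Delta^N_\star$.
   Context: Network (standing assumptions). $(N,E)$ is a fixed finite directed graph with $|N|\ge 3$ nodes (called agents), $E\subseteq N\times N$; it is connected, has no directed cycles, and has a unique node $s$ (the source) without incoming edges. Write $i\to j$ or $ij$ for an edge $(i,j)\in E$, and $N_i^+=\{j\in N: i\to j\}$. A sink is a node with $N_i^+=\emptyset$. A path is a directed path from $s$ to a sink; $\mathcal{P}$ is the set of paths. For a path or subpath $P$, $N_P$ and $E_P$ are its sets of nodes and edges. $\mathcal{P}_i^-$ is the set of directed subpaths from $s$ to $i$ (histories; $\mathcal{P}_s^-$ consists of the trivial subpath). No bottlenecks: for each agent $i$ that is neither the source nor a sink there is $P\in\mathcal{P}$ with $i\notin N_P$. Losses. A loss function is a map $\ell:E\to\mathbb{R}_{\ge 0}$; $\mathcal{L}$ is the set of all of them. For a path or subpath $P$, $\ell(P)=\sum_{e\in E_P}\ell(e)$. The set of efficient paths is $\mathcal{E}(\ell)=\arg\min_{P\in\mathcal{P}}\ell(P)$. Rules. A (liability) rule is a map $\phi:\mathcal{P}\times\mathcal{L}\to\mathbb{R}^N_{\ge 0}$ with $\sum_{i\in N}\phi_i(P,\ell)=\ell(P)$ for all $P\in\mathcal{P}$, $\ell\in\mathcal{L}$. Induced game $\mathcal{G}(\ell;\phi)$. This is an extensive-form game of perfect information: the source picks a successor $i\in N_s^+$, then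 $i$ picks a successor in $N_i^+$, and so on until a sink is reached. A (pure) strategy of a non-sink agent $i$ is a function $\sigma_i:\mathcal{P}_i^-\to N_i^+$; sinks make no choices. $\Pi(\sigma)\in\mathcal{P}$ is the path realized under the strategy profile $\sigma$. Each agent $j$ wants to minimize its liability $\phi_j(\Pi(\sigma),\ell)$. Equilibrium means (pure) subgame-perfect equilibrium, and $\mathcal{S}(\ell;\phi)\subseteq\mathcal{P}$ is the set of paths $\Pi(\sigma)$ realized by subgame-perfect equilibria $\sigma$ of $\mathcal{G}(\ell;\phi)$. Axioms for a rule $\phi$. - Efficient implementation: $\mathcal{S}(\ell;\phi)=\mathcal{E}(\ell)$ for every $\ell\in\mathcal{L}$. - Realized-loss dependence: for each $P\in\mathcal{P}$ and all $\ell,\ell'\in\mathcal{L}$, if $\ell(e)=\ell'(e)$ for each $e\in E_P$ then $\phi(P,\ell)=\phi(P,\ell')$. - Pairwise collusion-proofness: for each $\ell\in\mathcal{L}$ and each equilibrium strategy profile $\sigma$ of $\mathcal{G}(\ell;\phi)$ with path $P=\Pi(\sigma)$, each (non-sink) agent $i$, each strategy $\sigma_i'$ of $i$ inducing path $P'=\Pi((\sigma_i',\sigma_{-i}))$, and each agent $j\in N$: $\phi_i(P,\ell)+\phi_j(P,\ell)\le\phi_i(P',\ell)+\phi_j(P',\ell)$. - Scale invariance: $\phi(P,\alpha\cdot\ell)=\alpha\cdot\phi(P,\ell)$ for each $P\in\mathcal{P}$, $\ell\in\mathcal{L}$, and scalar $\alpha>0$. Fixed-weight rules. $\Delta^N=\{w\in\mathbb{R}^N_{\ge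 0}:\sum_{i\in N}w_i=1\}$. For $w\in\Delta^N$, the fixed-weight rule $\phi^w$ is $\phi^w(P,\ell)=w\cdot\ell(P)$, i.e. $\phi^w_i(P,\ell)=w_i\,\ell(P)$. Moreover $\Delta^N_\star=\{w\in\Delta^N: w_i>0\text{ for all agents } i\in N\text{ with }|N_i^+|>1\}$. *)

(* Defs.v *)
From mathcomp Require Import all_boot all_order all_algebra.
From mathcomp Require Import classical_sets reals interval_inference.

Set Implicit Arguments.
Unset Strict Implicit.
Unset Printing Implicit Defensive.

Import Order.TTheory GRing.Theory Num.Theory.
Local Open Scope ring_scope.

Definition out (N : finType) (E : rel N) (i : N) : {set N} := [set j | E i j].

Definition sink (N : finType) (E : rel N) (i : N) : bool := out E i == finset.set0.

(* [connected] is connectedness of the underlying undirected graph; [acyclic]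
   also excludes loops, since [cycle E [:: x]] unfolds to [E x x].  A directed
   subpath starting at [source] is represented by the sequence [p] of the nodes
   that follow [source] on it. *)
Record network := Network {
  node :> finType;
  edge : rel node;
  source : node;
  card_node : (3 <= #|node|)%N;
  connected : forall x y, connect (fun a b => edge a b || edge b a) x y;
  acyclic : forall c : seq node, cycle edge c -> c = [::];
  source_no_in : forall i, ~~ edge i source;
  source_unique : forall i, (forall j, ~~ edge j i) -> i = source;
  no_bottleneck : forall i, i != source -> ~~ sink edge i ->
    exists p : seq node, [/\ path edge source p,
      sink edge (last source p) & i \notin source :: p]
}.
Arguments edge {n} : rename.
Arguments source {n} : rename.

Section Paths.
Variable G : network.

Definition history := {p : seq G | path edge source p}.

Definition endpoint (h : history) : G := last source (val h).

Definition history_at (i : G) := {h : history | endpoint h == i}.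

Definition full_path := {h : history | sink edge (endpoint h)}.

Definition arc := {e : G * G | edge e.1 e.2}.

Definition arcs_of (h : history) : {set arc} :=
  [set e : arc | val e \in zip (source :: val h) (val h)].

Definition root_history : history :=
  exist (fun p => is_true (path edge source p)) [::] isT.

Lemma extend_subproof (h : history) (j : {j | edge (endpoint h) j}) :
  path edge source (rcons (val h) (val j)).
Proof. by rewrite rcons_path (valP h) (valP j). Qed.

Definition extend (h : history) (j : {j | edge (endpoint h) j}) : history :=
  exist (fun p => is_true (path edge source p)) _ (extend_subproof j).

End Paths.

Section Game.
Variable G : network.

Definition mover := {i : G | ~~ sink edge i}.

Definition strategy (i : mover) := history_at (val i) -> {j : G | edge (val i) j}.

Definition profile := forall i : mover, strategy i.

Definition deviate (sigma : profile) (i : mover) (tau : strategy i) : profile :=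
  dfwith sigma tau.

Definition step (sigma : profile) (h : history G) : history G :=
  match boolP (sink edge (endpoint h)) with
  | AltTrue _ => h
  | AltFalse Hi =>
      extend (sigma (exist (fun i => is_true (~~ sink edge i)) (endpoint h) Hi)
        (exist (fun h' => is_true (endpoint h' == endpoint h)) h (eqxx _)))
  end.

Lemma path_uniq (x : G) (p : seq G) : path edge x p -> uniq (x :: p).
Proof.
elim: p x => [//|y p IHp] x xyp.
have /andP[exy py] := xyp.
rewrite cons_uniq IHp // andbT; apply/negP => xp.
case/splitPr: xp xyp => p1 p2; rewrite cat_path => /andP[p1x /= /andP[lx _]].
suff /acyclic : cycle edge (x :: p1) by [].
by rewrite /= rcons_path p1x.
Qed.

Lemma size_history (h : history G) : (size (val h) < #|G|)%N.
Proof.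
have /card_uniqP /= <- := path_uniq (valP h).
exact: max_card.
Qed.

Lemma play_subproof (sigma : profile) (h : history G) :
  sink edge (endpoint (iter #|G| (step sigma) h)).
Proof.
suff H n : sink edge (endpoint (iter n (step sigma) h)) ||
           (n <= size (val (iter n (step sigma) h)))%N.
  by have := H #|G|; rewrite [(#|G| <= _)%N]leqNgt size_history orbF.
elim: n => [|n IHn]; first by rewrite leq0n orbT.
rewrite iterS; move: (iter n _ h) IHn => k; rewrite /step.
destruct (boolP (sink edge (endpoint k))) as [hk|hk].
  by rewrite hk.
by rewrite /= => nk; rewrite size_rcons ltnS nk orbT.
Qed.

(* The path realized when play starts at [h] and continues according to
   [sigma].  By acyclicity [#|G|] moves suffice, and [step] is the identity once
   a sink has been reached. *)
Definition play (sigma : profile) (h : history G) : full_path G :=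
  exist (fun h => is_true (sink edge (endpoint h))) _ (play_subproof sigma h).

Definition outcome (sigma : profile) : full_path G := play sigma (root_history G).

End Game.

Section Rules.
Variables (R : realType) (G : network).

Definition loss := {ffun arc G -> {nonneg R}}.

Definition total_loss (l : loss) (P : full_path G) : R :=
  \sum_(e in arcs_of (val P)) (l e)%:num.

Definition scale (a : {posnum R}) (l : loss) : loss :=
  [ffun e => (a%:num * (l e)%:num)%:nng].

Definition efficient (l : loss) : set (full_path G) :=
  [set P | forall Q, total_loss l P <= total_loss l Q]%classic.

Record rule := Rule {
  liability :> full_path G -> loss -> {ffun G -> R};
  liability_ge0 : forall P l i, 0 <= liability P l i;
  liability_sum : forall P l, \sum_i liability P l i = total_loss l P
}.

(* Subgames correspond to the histories [h]; payoffs in the subgame at [h] are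
   those of the whole path through [h]. *)
Definition equilibrium (phi : rule) (l : loss) (sigma : profile G) : Prop :=
  forall (h : history G) (i : mover G) (tau : strategy i),
    phi (play sigma h) l (val i) <= phi (play (deviate sigma tau) h) l (val i).

Definition equilibrium_paths (phi : rule) (l : loss) : set (full_path G) :=
  [set outcome sigma | sigma in equilibrium phi l]%classic.

Definition efficient_implementation (phi : rule) : Prop :=
  forall l, equilibrium_paths phi l = efficient l.

Definition realized_loss_dependence (phi : rule) : Prop :=
  forall (P : full_path G) (l l' : loss),
    (forall e, e \in arcs_of (val P) -> l e = l' e) -> phi P l = phi P l'.

Definition pairwise_collusion_proof (phi : rule) : Prop :=
  forall (l : loss) (sigma : profile G), equilibrium phi l sigma ->
  forall (i : mover G) (tau : strategy i) (j : G),
    let P := outcome sigma in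
    let P' := outcome (deviate sigma tau) in
    phi P l (val i) + phi P l j <= phi P' l (val i) + phi P' l j.

Definition scale_invariant (phi : rule) : Prop :=
  forall (P : full_path G) (l : loss) (a : {posnum R}) (i : G),
    phi P (scale a l) i = a%:num * phi P l i.

Definition simplex : set {ffun G -> R} :=
  [set w : {ffun G -> R} | (forall i, 0 <= w i) /\ \sum_i w i = 1]%classic.

Definition simplex_star : set {ffun G -> R} :=
  [set w | simplex w /\
    forall i : G, (1 < #|out edge i|)%N -> 0 < (w : {ffun G -> R}) i]%classic.

Definition fixed_weight (w : {ffun G -> R}) (P : full_path G) (l : loss) :
  {ffun G -> R} := [ffun i => w i * total_loss l P].

End Rules.

(* Main.v *)
From mathcomp Require Import boolp classical_sets reals interval_inference.
From mathcomp Require Import all_boot all_order all_algebra.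
Require Import Defs.

(* If two paths [P] and [Q] are efficient for the same losses, they impose the
   same liabilities.  Indeed, let them diverge at a history [k] with mover [i].
   By efficient implementation some equilibrium realizes [P].  Charging the arcs
   that no path through a successor of [k] uses leaves the subgame there intact
   but forces all efficient paths through it, so the equilibrium is efficient in
   that subgame as well.  Hence when [i] switches towards [Q] the realized path
   is efficient and shares more with [Q]; by induction it imposes the
   liabilities of [Q], and collusion-proofness gives
   [phi_i + phi_j] at [P] at most [phi_i + phi_j] at [Q], and conversely by
   symmetry.  Taking [j = i] first, all liabilities agree.

   Losses that are differences of a node potential, equal to [0] at the source
   and to [L] at all sinks, make every path along which the potential increases
   efficient with loss [L].  Any losses on a path [P] come from such a potential,
   whose value at an inner node can be erased by comparison with a path that
   avoids the node.  So the liability depends only on the total loss of the path,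
   and scale invariance makes it linear. *)

Set Implicit Arguments.
Unset Strict Implicit.
Unset Printing Implicit Defensive.

Import Order.TTheory GRing.Theory Num.Theory.
Local Open Scope ring_scope.

(** * Histories *)

Section Histories.
Variable G : network.
Implicit Types (h k : history G) (P Q : full_path G) (x y : G) (e : arc G).

(** The number of ancestors, [x] included: a topological numbering, which orders the nodes of every
    path. *)
Definition rank x : nat := #|finset (fun y => connect edge y x)|.

Lemma rank_edge x y : edge x y -> (rank x < rank y)%N.
Proof.
move=> xy; apply: proper_card; apply/properP; split.
  by apply/subsetP => z; rewrite !inE => zx; exact: connect_trans (connect1 xy).
exists y; rewrite !inE ?connect0 //; apply/negP => /connectP[p py xp].
suff /acyclic : cycle edge (y :: p) by [].
by rewrite /= rcons_path py -xp.
Qed.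

Lemma history_ind (K : history G -> Prop) :
  K (root_history G) ->
  (forall h (j : {j | edge (endpoint h) j}), K h -> K (extend j)) ->
  forall h, K h.
Proof.
move=> K0 Kext [p]; elim/last_ind: p => [|p x IHp] sp.
  by rewrite (_ : exist _ _ _ = root_history G) //; exact: val_inj.
have /andP[pp px] : path edge source p && edge (last source p) x.
  by rewrite -rcons_path.
rewrite (_ : exist _ _ _ =
  @extend G (exist _ p pp) (exist (fun j => is_true (edge _ j)) x px)).
  exact/Kext/IHp.
exact: val_inj.
Qed.

(** Induction from the sinks back to the source; it ends because a history has fewer than [#|G|]
    arcs. *)
Lemma history_coind (K : history G -> Prop) :
  (forall h, (forall j : {j | edge (endpoint h) j}, K (extend j)) -> K h) ->
  forall h, K h.
Proof.
move=> Kext h; have [n] := ubnP (#|G| - size (val h))%N.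
elim: n h => // n IHn h; rewrite ltnS => hn.
apply: Kext => j; apply: IHn; rewrite /= size_rcons.
by apply: leq_trans hn; rewrite ltn_sub2l // size_history.
Qed.

Definition nodes h : seq G := source :: val h.

Lemma endpoint_extend h (j : {j | edge (endpoint h) j}) :
  endpoint (extend j) = val j.
Proof. by rewrite /endpoint /= last_rcons. Qed.

Lemma endpoint_nodes h : endpoint h \in nodes h.
Proof. exact: mem_last. Qed.

Lemma nodes_extend h (j : {j | edge (endpoint h) j}) x :
  (x \in nodes (extend j)) = (x == val j) || (x \in nodes h).
Proof. by rewrite /nodes /= !inE mem_rcons inE orbCA. Qed.

Lemma rank_endpoint h x : x \in nodes h -> (rank x <= rank (endpoint h))%N.
Proof.
elim/history_ind: h => [|h j IHh]; first by rewrite inE => /eqP->.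
rewrite nodes_extend endpoint_extend => /predU1P[-> //|/IHh xh].
exact: leq_trans xh (ltnW (rank_edge (valP j))).
Qed.

Lemma rank_source h x : x \in nodes h -> (rank source <= rank x)%N.
Proof.
elim/history_ind: h => [|h j IHh]; first by rewrite inE => /eqP->.
rewrite nodes_extend => /predU1P[->|//].
apply: leq_trans (ltnW (rank_edge (valP j))).
by apply: rank_endpoint; rewrite inE eqxx.
Qed.

Lemma rank_inj h : {in nodes h &, injective rank}.
Proof.
elim/history_ind: h => [|h j IHh] x y.
  by rewrite !inE => /eqP-> /eqP->.
have ltj z : z \in nodes h -> (rank z < rank (val j))%N.
  by move=> zh; exact: leq_ltn_trans (rank_endpoint zh) (rank_edge (valP j)).
rewrite !nodes_extend => /predU1P[->|xh] /predU1P[->|yh] //.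
- by move=> eq_jy; have := ltj _ yh; rewrite eq_jy ltnn.
- by move=> eq_xj; have := ltj _ xh; rewrite eq_xj ltnn.
- exact: IHh.
Qed.

Lemma sink_endpoint h x : x \in nodes h -> sink edge x -> x = endpoint h.
Proof.
elim/history_ind: h => [|h j IHh]; first by rewrite inE => /eqP->.
rewrite nodes_extend endpoint_extend => /predU1P[-> //|xh sx].
by have /setP/(_ (val j)) := eqP sx; rewrite !inE (IHh xh sx) (valP j).
Qed.

Definition last_arc h (j : {j | edge (endpoint h) j}) : arc G :=
  exist (fun e : G * G => is_true (edge e.1 e.2)) (endpoint h, val j) (valP j).

Lemma arcs_of_root : arcs_of (root_history G) = finset.set0.
Proof. by apply/setP => e; rewrite !inE. Qed.

Lemma arcs_of_extend h (j : {j | edge (endpoint h) j}) :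
  arcs_of (extend j) = (last_arc j |: arcs_of h)%SET.
Proof.
apply/setP => e; rewrite !inE /=.
have -> (p : seq G) (s x : G) :
    zip (s :: rcons p x) (rcons p x) = rcons (zip (s :: p) p) (last s p, x).
  by elim: p s => //= y p IHp s; rewrite IHp.
by rewrite mem_rcons inE -val_eqE.
Qed.

Lemma arc_nodes h e : e \in arcs_of h ->
  (val e).1 \in nodes h /\ (val e).2 \in nodes h.
Proof.
elim/history_ind: h => [|h j IHh]; first by rewrite arcs_of_root inE.
rewrite arcs_of_extend !nodes_extend in_setU1 => /predU1P[->|/IHh[-> ->]].
  by rewrite /= eqxx endpoint_nodes orbT.
by rewrite !orbT.
Qed.

Lemma last_arc_notin h (j : {j | edge (endpoint h) j}) :
  last_arc j \notin arcs_of h.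
Proof.
apply/negP => /arc_nodes[_ /rank_endpoint].
by rewrite leqNgt rank_edge // (valP j).
Qed.

(** Ranks increase along a history, so it leaves each node at most once. *)
Lemma arc_source_inj h : {in arcs_of h &, forall e f,
  (val e).1 = (val f).1 -> e = f}.
Proof.
have no h' (j : {j | edge (endpoint h') j}) e :
    e \in arcs_of h' -> (val e).1 = endpoint h' -> False.
  move=> /arc_nodes[_ /rank_endpoint] + eqe.
  by rewrite -eqe leqNgt rank_edge // (valP e).
elim/history_ind: h => [|h j IHh] e f; first by rewrite arcs_of_root inE.
rewrite arcs_of_extend !in_setU1 => /predU1P[->|eh] /predU1P[->|fh] //.
- by move=> /= /esym /(no _ j _ fh).
- by move=> /= /(no _ j _ eh).
- exact: IHh.
Qed.

(** * Prefixes of histories, that is, subgames *)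

Definition through k h := prefix (val k) (val h).

Lemma through_refl h : through h h. Proof. exact: prefix_refl. Qed.

Lemma through_root h : through (root_history G) h. Proof. exact: prefix0s. Qed.

Lemma through_trans k h g : through k h -> through h g -> through k g.
Proof. exact: prefix_trans. Qed.

Lemma through_extend h (j : {j | edge (endpoint h) j}) : through h (extend j).
Proof. exact: prefix_rcons. Qed.

Lemma through_leq k h g : through k g -> through h g ->
  (size (val k) <= size (val h))%N -> through k h.
Proof.
rewrite /through !prefixE => /eqP kg /eqP hg le_kh.
by rewrite -{1}hg take_takel // kg.
Qed.

Lemma through_eq k h : through k h -> (size (val h) <= size (val k))%N -> h = k.
Proof.
rewrite /through prefixE => /eqP kh le_hk.
by apply: val_inj; rewrite -kh take_oversize.
Qed.

Lemma through_arc k (j : {j | edge (endpoint k) j}) h :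
  through (extend j) h -> last_arc j \in arcs_of h.
Proof.
elim/history_ind: h => [|h j' IHh].
  by move=> /size_prefix; rewrite /= size_rcons.
move=> kh; rewrite arcs_of_extend in_setU1.
have [le_h|lt_h] := leqP (size (val (extend j'))) (size (val (extend j))).
  have /(congr1 val) /= /rcons_inj[eq_h eq_j] := through_eq kh le_h.
  apply/orP; left; rewrite -val_eqE; apply/eqP.
  by rewrite /= eq_j; congr (last _ _, _); exact: esym eq_h.
rewrite IHh ?orbT //; apply: through_leq kh (through_extend _) _.
by move: lt_h; rewrite /= !size_rcons ltnS.
Qed.

Lemma through_sink k h : through k h -> sink edge (endpoint k) -> h = k.
Proof.
move=> /prefixP[[|x q]] => [|hq sk]; first by rewrite cats0 => /val_inj.
have := valP h; rewrite hq cat_path /= => /and3P[_ kx _].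
by have /setP/(_ x) := eqP sk; rewrite !inE [edge _ _]kx.
Qed.

Lemma through_next k P : through k (val P) -> ~~ sink edge (endpoint k) ->
  exists j : {j | edge (endpoint k) j}, through (extend j) (val P).
Proof.
move=> /prefixP[[|x q] Pq].
  move: Pq; rewrite cats0 => /val_inj <-; by rewrite (valP P).
move=> _; have := valP (val P); rewrite Pq cat_path /= => /and3P[_ kx _].
exists (exist (fun j => is_true (edge _ j)) x kx).
by rewrite /through /= Pq -cat_rcons prefix_prefix.
Qed.

Lemma through_next_uniq k (a b : {j | edge (endpoint k) j}) h :
  through (extend a) h -> through (extend b) h -> a = b.
Proof.
move=> /through_arc ah /through_arc bh; apply: val_inj.
by have /(_ erefl)/(congr1 val)[] := arc_source_inj ah bh.
Qed.

(** [D] collects the arcs that leave a node of [k] before its end without following [k]. A path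
    through [k] leaves each such node along [k]; any other path uses an arc of [D] where it departs
    from [k]. *)
Lemma diverging_arcs k : exists D : {set arc G},
  (forall h, through k h -> [disjoint arcs_of h & D]) /\
  (forall P, ~~ through k (val P) ->
    exists2 e, e \in arcs_of (val P) & e \in D).
Proof.
elim/history_ind: k => [|k j [D [D_in D_out]]].
  exists finset.set0; split=> [h _|P].
    by apply/pred0P => e; rewrite !inE andbF.
  by rewrite through_root.
exists (D :|: [set e | ((val e).1 == endpoint k) && ((val e).2 != val j)])%SET.
split=> [h jh|P njP].
  have kh := through_trans (through_extend j) jh.
  apply/pred0P => e /=; apply/negbTE/negP => /andP[eh].
  rewrite in_setU => /orP[eD|]; last rewrite inE => /andP[/eqP e1 /negP[]].
    by have /pred0P/(_ e) := D_in h kh; rewrite /= eh eD.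
  by rewrite (arc_source_inj eh (through_arc jh) e1).
have [kP|nkP] := boolP (through k (val P)); last first.
  by have [e eP eD] := D_out P nkP; exists e; rewrite // inE eD.
have nk : ~~ sink edge (endpoint k).
  by apply/negP => /eqP/setP/(_ (val j)); rewrite !inE (valP j).
have [j' j'P] := through_next kP nk.
exists (last_arc j'); first exact: through_arc.
rewrite !inE /= eqxx /=; apply/orP; right; apply: contraNneq njP => eqj.
by rewrite -(val_inj eqj).
Qed.

(** Trace incoming edges back from [x]: ranks fall, and only the source has none. *)
Lemma history_to x : exists h, endpoint h = x.
Proof.
have [n] := ubnP (rank x); elim: n x => // n IHn x; rewrite ltnS => xn.
have [->|xs] := eqVneq x source; first by exists (root_history G).
have [y yx] : exists y, edge y x.
  apply/existsP; apply: contra_neqT xs; rewrite negb_exists => /forallP.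
  exact: source_unique.
have [h hy] := IHn y (leq_trans (rank_edge yx) xn); rewrite -hy in yx.
exists (extend (exist (fun j => is_true (edge _ j)) x yx)).
by rewrite endpoint_extend.
Qed.

Lemma edge_nonsink x y : edge x y -> ~~ sink edge x.
Proof. by move=> xy; apply/negP => /eqP/setP/(_ y); rewrite !inE xy. Qed.

Lemma path_avoiding x : x != source -> ~~ sink edge x ->
  exists Q, x \notin nodes (val Q).
Proof.
move=> xs nx; have [p [pp sp xp]] := no_bottleneck xs nx.
by exists (exist (fun h => is_true (sink edge (endpoint h)))
                 (exist (fun p => is_true (path edge source p)) p pp) sp).
Qed.

End Histories.

(** * Strategies and backward induction *)

Section Strategies.
Variable G : network.
Implicit Types (h k : history G) (P Q : full_path G) (sigma : profile G).

Definition next sigma h (nh : ~~ sink edge (endpoint h)) :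
    {j | edge (endpoint h) j} :=
  sigma (exist (fun i => is_true (~~ sink edge i)) (endpoint h) nh)
    (exist (fun h' => is_true (endpoint h' == endpoint h)) h (eqxx _)).

Lemma step_sink sigma h : sink edge (endpoint h) -> step sigma h = h.
Proof.
move=> sh; rewrite /step; destruct (boolP _) as [|nh] => //.
by have /negP[] := nh.
Qed.

Lemma step_next sigma h (nh : ~~ sink edge (endpoint h)) :
  step sigma h = extend (next sigma nh).
Proof.
rewrite /step; destruct (boolP _) as [sh|nh'].
  by have /negP[] := nh.
by rewrite (bool_irrelevance nh nh').
Qed.

Lemma play_sink sigma h : sink edge (endpoint h) -> val (play sigma h) = h.
Proof. by move=> sh /=; elim: #|G| => //= n ->; exact: step_sink. Qed.

Lemma play_next sigma h (nh : ~~ sink edge (endpoint h)) :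
  play sigma h = play sigma (extend (next sigma nh)).
Proof.
(* A sink is reached within [#|G|] moves, so one further step changes nothing. *)
apply: val_inj; rewrite -step_next /= -iterSr iterS step_sink //.
exact: valP (play sigma h).
Qed.

Lemma play_through sigma h : through h (val (play sigma h)).
Proof.
elim/history_coind: h => h IHh.
have [sh|nh] := boolP (sink edge (endpoint h)).
  by rewrite play_sink // through_refl.
by rewrite (play_next sigma nh); exact: through_trans (through_extend _) (IHh _).
Qed.

(** [S] is closed under moves, as a subgame is, so play that starts in it never leaves it. *)
Lemma eq_play (S : pred (history G)) sigma sigma' :
  (forall h (j : {j | edge (endpoint h) j}), S h -> S (extend j)) ->
  (forall h (nh : ~~ sink edge (endpoint h)), S h ->
    next sigma nh = next sigma' nh) ->
  forall h, S h -> play sigma h = play sigma' h.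
Proof.
move=> Sext eq_next; elim/history_coind => h IHh Sh.
have [sh|nh] := boolP (sink edge (endpoint h)).
  by apply: val_inj; rewrite !play_sink.
by rewrite !(play_next _ nh) eq_next // IHh // Sext.
Qed.

Section ProfileOf.
Variable c : forall h, ~~ sink edge (endpoint h) -> {j | edge (endpoint h) j}.

Lemma history_at_nonsink (i : mover G) (x : history_at (val i)) :
  ~~ sink edge (endpoint (val x)).
Proof. by rewrite (eqP (valP x)) (valP i). Qed.

Lemma profile_of_edge (i : mover G) (x : history_at (val i)) :
  edge (val i) (val (c (history_at_nonsink x))).
Proof. by move: (valP (c (history_at_nonsink x))); rewrite {1}(eqP (valP x)). Qed.

Definition profile_of : profile G := fun i x =>
  exist (fun j => is_true (edge (val i) j)) _ (profile_of_edge x).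

Lemma next_profile_of h (nh : ~~ sink edge (endpoint h)) :
  next profile_of nh = c nh.
Proof. by apply: val_inj => /=; congr (val (c _)); exact: bool_irrelevance. Qed.

End ProfileOf.

Lemma profile_exists : exists sigma : profile G, True.
Proof.
have out_ex h : ~~ sink edge (endpoint h) ->
    exists j : {j | edge (endpoint h) j}, True.
  move=> /set0Pn[j]; rewrite inE => hj.
  by exists (exist (fun j => is_true (edge _ j)) j hj).
by exists (profile_of (fun h nh => sval (cid (out_ex h nh)))).
Qed.

(** [move] prescribes the choices at some histories; the others are optimal against a change of that
    single choice. Prescribed choices need not be optimal, so each use has to check them. *)
Lemma backward_induction (R : realType) (cost : G -> full_path G -> R)
    (move : history G -> option G) :
  (forall h j, move h = Some j -> edge (endpoint h) j) ->
  exists sigma, forall h (nh : ~~ sink edge (endpoint h)),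
    if move h is Some j then val (next sigma nh) = j
    else forall j : {j | edge (endpoint h) j},
      cost (endpoint h) (play sigma h) <=
      cost (endpoint h) (play sigma (extend j)).
Proof.
move=> moveE.
pose good (F : history G -> full_path G) h (a : {j | edge (endpoint h) j}) :=
  if move h is Some j then val a = j else forall j : {j | edge (endpoint h) j},
      cost (endpoint h) (F (extend a)) <= cost (endpoint h) (F (extend j)).
have [sigma0 _] := profile_exists.
have good_ex sigma h (nh : ~~ sink edge (endpoint h)) :
    exists a : {j | edge (endpoint h) j}, good (play sigma) h a.
  rewrite /good; case def_m: (move h) => [j|].
    by exists (exist (fun j => is_true (edge _ j)) j (moveE _ _ def_m)).
  pose f (a : {j | edge (endpoint h) j}) :=
    cost (endpoint h) (play sigma (extend a)).
  have [a _ amin] := arg_minP f (P := predT) (i0 := next sigma0 nh) isT.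
  by exists a => j; exact: amin.
suff [sigma sigmaP] : exists sigma, forall h (nh : ~~ sink edge (endpoint h)),
    (#|G| <= size (val h) + #|G|)%N -> good (play sigma) h (next sigma nh).
  exists sigma => h nh; have := sigmaP h nh (leq_addl _ _).
  by rewrite /good -play_next.
(* Stage [n] settles the histories with at least [#|G| - n] arcs. None has [#|G|] arcs, so any
   profile serves at stage 0. *)
elim: {2}#|G| => [|n [sigma sigmaP]].
  by exists sigma0 => h nh; rewrite addn0 leqNgt size_history.
pose late h := (#|G| <= size (val h) + n)%N.
have lateS h (j : {j | edge (endpoint h) j}) : late h -> late (extend j).
  by rewrite /late /= size_rcons => /leq_trans-> //; rewrite leq_add2r.
(* Settled choices are kept, the others are made well against [sigma]. One arc before the settled
   histories they are also good against [tau], since play continues as under [sigma]. *)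
pose tau := profile_of (fun h nh =>
  if late h then next sigma nh else sval (cid (good_ex sigma h nh))).
have eq_late h : late h -> play tau h = play sigma h.
  apply: (eq_play lateS) => {}h nh hl.
  by rewrite next_profile_of hl.
exists tau => h nh hn; rewrite next_profile_of.
have hext (j : {j | edge (endpoint h) j}) :
    play tau (extend j) = play sigma (extend j).
  by apply: eq_late; rewrite /late /= size_rcons addSnnS.
suff good_tau a : good (play sigma) h a -> good (play tau) h a.
  apply: good_tau.
  by case: ifP => [/sigmaP //|_]; case: (cid _).
by rewrite /good; case: (move h) => // + j; rewrite !hext.
Qed.

(** A one-shot deviation. *)
Definition switch sigma h (nh : ~~ sink edge (endpoint h))
    (j : {j | edge (endpoint h) j}) :
    strategy (exist (fun i => is_true (~~ sink edge i)) (endpoint h) nh) :=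
  fun x => if val x == h then j else sigma _ x.

Lemma next_deviate sigma (i : mover G) (tau : strategy i) h
    (nh : ~~ sink edge (endpoint h)) :
  endpoint h != val i -> next (deviate sigma tau) nh = next sigma nh.
Proof.
move=> hi; rewrite /next /deviate dfwith_out //.
by apply: contra hi => /eqP->.
Qed.

Lemma next_switch sigma h (nh : ~~ sink edge (endpoint h)) j :
  next (deviate sigma (switch sigma (nh := nh) j)) nh = j.
Proof. by rewrite /next /deviate dfwith_in /switch eqxx. Qed.

Lemma next_switch_neq sigma h (nh : ~~ sink edge (endpoint h)) j h'
    (nh' : ~~ sink edge (endpoint h')) : h' != h ->
  next (deviate sigma (switch sigma (nh := nh) j)) nh' = next sigma nh'.
Proof.
move=> neq_h; rewrite /next /deviate.
(* Stated for an arbitrary mover [i], so that the equation between movers can be eliminated when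
   [h'] and [h] end at the same agent. *)
suff switchE (i : mover G) (x : history_at (val i)) : val x != h ->
    dfwith sigma (switch sigma (nh := nh) j) i x = sigma i x.
  exact: (switchE (exist _ (endpoint h') nh') (exist _ h' (eqxx _))).
have [E|neq_i] := eqVneq (exist _ (endpoint h) nh) i; last first.
  by rewrite dfwith_out.
by case: _ / E x => x xh; rewrite dfwith_in /switch (negbTE xh).
Qed.

Lemma play_switch sigma h (nh : ~~ sink edge (endpoint h)) j k :
  through k h -> through h (val (play sigma k)) ->
  play (deviate sigma (switch sigma (nh := nh) j)) k = play sigma (extend j).
Proof.
elim/history_coind: k => k IHk kh hk.
have [eq_kh|neq_kh] := eqVneq k h.
  rewrite {}eq_kh in IHk kh hk *.
  rewrite (play_next _ nh) next_switch.
  (* After [h] all histories are longer, so the switched choice never recurs. *)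
  apply: (@eq_play (fun g => size (val h) < size (val g))%N).
  - by move=> g a; rewrite /= size_rcons => /ltnW.
  - move=> g ng hg; rewrite next_switch_neq //.
    by apply: contraTneq hg => ->; rewrite ltnn.
  - by rewrite /= size_rcons.
have nk : ~~ sink edge (endpoint k).
  by apply: contra neq_kh => sk; rewrite (through_sink kh sk).
rewrite (play_next _ nk) next_switch_neq //.
rewrite (play_next _ nk) in hk.
apply: IHk (hk); apply: through_leq (play_through _ _) hk _.
rewrite /= size_rcons ltnNge; apply: contra neq_kh => le_hk.
by rewrite (through_eq kh le_hk).
Qed.

End Strategies.

Lemma play_on_path (G : network) (sigma : profile G) (h k : history G) :
  through h k -> through k (val (play sigma h)) -> play sigma k = play sigma h.
Proof.
elim/history_coind: h => h IHh hk kh.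
have [->//|neq_hk] := eqVneq h k.
have nh : ~~ sink edge (endpoint h).
  by apply: contra neq_hk => sh; rewrite (through_sink hk sh).
rewrite (play_next _ nh) in kh *; apply: IHh => //.
apply: through_leq (play_through _ _) kh _.
rewrite /= size_rcons ltnNge; apply: contra neq_hk => le_kh.
by rewrite (through_eq hk le_kh).
Qed.

(** * Losses, potentials and liabilities *)

Section Losses.
Variables (R : realType) (G : network).
Implicit Types (h k : history G) (P Q : full_path G) (l : loss R G).
Implicit Types (sigma : profile G) (phi : rule R G) (d : G -> R).

Definition history_loss l h : R := \sum_(e in arcs_of h) (l e)%:num.

Lemma history_loss_root l : history_loss l (root_history G) = 0.
Proof. by rewrite /history_loss arcs_of_root big_set0. Qed.

Lemma history_loss_extend l h (j : {j | edge (endpoint h) j}) :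
  history_loss l (extend j) = history_loss l h + (l (last_arc j))%:num.
Proof.
by rewrite /history_loss arcs_of_extend big_setU1 ?last_arc_notin // addrC.
Qed.

(** The one-shot deviation principle: a deviation splits into its first move, covered by the
    one-shot condition, and its continuation, covered by induction. *)
Lemma equilibriumP phi l sigma :
  (forall h (nh : ~~ sink edge (endpoint h)) (j : {j | edge (endpoint h) j}),
     phi (play sigma h) l (endpoint h) <=
     phi (play sigma (extend j)) l (endpoint h)) <->
  equilibrium phi l sigma.
Proof.
split=> [opt h i tau|eqs h nh j]; last first.
  by have := eqs h _ (switch sigma (nh := nh) j);
    rewrite play_switch ?through_refl ?play_through.
elim/history_coind: h => h IHh.
have [sh|nh] := boolP (sink edge (endpoint h)).
  rewrite (_ : play sigma h = play (deviate sigma tau) h) //.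
  by apply: val_inj; rewrite !play_sink.
have [eq_i|neq_i] := eqVneq (endpoint h) (val i); last first.
  by rewrite !(play_next _ nh) next_deviate.
rewrite [play (deviate _ _) _](play_next _ nh); apply: le_trans (IHh _).
by rewrite -eq_i; exact: opt.
Qed.

(** Each arc of [diverging_arcs] is charged 1 more. If some path through [k] is efficient for [l],
    then all paths efficient for [l'] pass through [k]. *)
Lemma surcharge l k : exists l' : loss R G,
  (forall P, through k (val P) -> forall e, e \in arcs_of (val P) -> l' e = l e)
  /\ (forall P, ~~ through k (val P) -> total_loss l P + 1 <= total_loss l' P).
Proof.
have [D [D_in D_out]] := diverging_arcs k.
exists [ffun e => ((l e)%:num + (e \in D)%:R)%:nng]; split=> P kP.
  move=> e eP; apply: val_inj; rewrite ffunE /=.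
  by rewrite (disjointFr (D_in _ kP) eP) addr0.
have [e eP eD] := D_out P kP; rewrite /total_loss.
under [leRHS]eq_bigr => f _ do rewrite ffunE /=.
rewrite big_split lerD2l (bigD1 e) //= eD lerDl.
by apply: sumr_ge0 => f _; exact: ler0n.
Qed.

Lemma eq_total_loss l l' P : (forall e, e \in arcs_of (val P) -> l e = l' e) ->
  total_loss l P = total_loss l' P.
Proof. by move=> eq_l; apply: eq_bigr => e eP; rewrite eq_l. Qed.

Lemma subgame_efficient phi l sigma k Q :
  efficient_implementation phi -> realized_loss_dependence phi ->
  equilibrium phi l sigma -> efficient l Q -> through k (val Q) ->
  efficient l (play sigma k).
Proof.
move=> EI RLD eqs effQ kQ.
have [l' [l'_in l'_out]] := surcharge l k.
(* The profile [tau] is to copy [sigma] in the subgame at [k] and to be optimal for [l']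
   elsewhere. *)
pose move h := if through k h then
    if boolP (sink edge (endpoint h)) is AltFalse nh
    then Some (val (next sigma nh)) else None
  else None.
have moveE h j : move h = Some j -> edge (endpoint h) j.
  rewrite /move; case: ifP => // _.
  by destruct (boolP _) => // -[<-]; exact: valP.
have [tau tauP] := backward_induction (fun i P => phi P l' i) moveE.
have eq_play_k h : through k h -> play tau h = play sigma h.
  move: h; apply: eq_play => [h j kh|h nh kh].
    exact: through_trans kh (through_extend j).
  have := tauP h nh; rewrite /move kh; destruct (boolP _) as [sh|nh'].
    by have /negP[] := nh.
  by rewrite (bool_irrelevance nh' nh) => /val_inj.
(* In the subgame, realized-loss dependence carries the equilibrium conditions from [l] to [l']. *)
have eqt : equilibrium phi l' tau.
  apply/equilibriumP => h nh j; have [kh|nkh] := boolP (through k h).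
    have kj : through k (extend j) := through_trans kh (through_extend j).
    have phiE g : through k g -> phi (play tau g) l' = phi (play sigma g) l.
      move=> kg; rewrite eq_play_k //; apply: RLD; apply: l'_in.
      exact: through_trans kg (play_through _ _).
    by rewrite !phiE //; move/equilibriumP: eqs; apply.
  by have := tauP h nh; rewrite /move (negbTE nkh); apply.
have efft : efficient l' (outcome tau) by rewrite -(EI l'); exists tau.
have eqQ : total_loss l' Q = total_loss l Q by apply: eq_total_loss; exact: l'_in.
(* Under [l'], a path that misses [k] loses at least 1 more than [Q]. *)
have kt : through k (val (outcome tau)).
  apply/negPn/negP => /l'_out; apply/negP; rewrite -ltNge.
  apply: le_lt_trans (efft Q) _; rewrite eqQ.
  by apply: le_lt_trans (effQ (outcome tau)) _; rewrite ltrDl.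
have eqk : play sigma k = outcome tau.
  by rewrite -eq_play_k ?through_refl // (play_on_path _ kt) ?through_root.
rewrite eqk => P; rewrite -(eq_total_loss (l'_in _ kt)).
by apply: le_trans (efft Q) _; rewrite eqQ; exact: effQ.
Qed.

Lemma efficient_liability phi l P Q :
  efficient_implementation phi -> realized_loss_dependence phi ->
  pairwise_collusion_proof phi ->
  efficient l P -> efficient l Q -> phi P l = phi Q l.
Proof.
move=> EI RLD PCP.
suff agree k : forall P Q, efficient l P -> efficient l Q ->
    through k (val P) -> through k (val Q) -> phi P l = phi Q l.
  by move=> effP effQ; apply: (agree (root_history G)); rewrite ?through_root.
elim/history_coind: k => k IHk {}P {}Q effP effQ kP kQ.
have [sk|nk] := boolP (sink edge (endpoint k)).
  congr (phi _ _); apply: val_inj.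
  by rewrite (through_sink kP sk) (through_sink kQ sk).
have collude P' Q' (j : G) : efficient l P' -> efficient l Q' ->
    through k (val P') -> through k (val Q') ->
    phi P' l (endpoint k) + phi P' l j <= phi Q' l (endpoint k) + phi Q' l j.
  move=> effP' effQ' kP' kQ'; have [b bQ'] := through_next kQ' nk.
  have [sigma eqs outP'] : equilibrium_paths phi l P' by rewrite EI.
  have := PCP l sigma eqs _ (switch sigma (nh := nk) b) j.
  rewrite /= /outcome play_switch ?through_root //; last first.
    by rewrite [play _ _]outP'.
  rewrite [play sigma (root_history G)]outP'.
  (* The path after the switch is efficient and shares the arc to [b] with [Q'], so induction gives
     it the liabilities of [Q']. *)
  rewrite (IHk b (play sigma (extend b)) Q') // ?play_through //.
  exact: subgame_efficient eqs effQ' bQ'.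
have eqj j : phi P l (endpoint k) + phi P l j = phi Q l (endpoint k) + phi Q l j.
  by apply: le_anti; rewrite !collude.
have eqk : phi P l (endpoint k) = phi Q l (endpoint k).
  by have := eqj (endpoint k); move/eqP; rewrite -!mulr2n eqrMn2r // => /eqP.
by apply/ffunP => j; have := eqj j; rewrite eqk; exact: addrI.
Qed.

(** * Losses derived from node potentials *)

Definition potential_loss d : loss R G :=
  [ffun e => `|d (val e).2 - d (val e).1|%:nng].

Lemma potential_lossE d e : d (val e).1 <= d (val e).2 ->
  (potential_loss d e)%:num = d (val e).2 - d (val e).1.
Proof. by move=> le_d; rewrite ffunE /= ger0_norm // subr_ge0. Qed.

Lemma eq_potential_loss d d' (h : history G) :
  {in nodes h, d =1 d'} ->
  forall e, e \in arcs_of h -> potential_loss d e = potential_loss d' e.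
Proof.
move=> eq_d e /arc_nodes[e1 e2].
by apply: val_inj; rewrite !ffunE /= !eq_d.
Qed.

(** Telescoping: by the absolute value in [potential_loss], each arc costs at least the rise of [d]
    along it, even where [d] falls. *)
Lemma potential_loss_ge d h :
  d (endpoint h) - d source <= history_loss (potential_loss d) h.
Proof.
elim/history_ind: h => [|h j IHh]; first by rewrite history_loss_root subrr.
rewrite history_loss_extend endpoint_extend.
rewrite -(subrKA (d (endpoint h))) addrC lerD //.
by rewrite ffunE /= ler_norm.
Qed.

Lemma potential_loss_eq d h :
  (forall e, e \in arcs_of h -> d (val e).1 <= d (val e).2) ->
  history_loss (potential_loss d) h = d (endpoint h) - d source.
Proof.
elim/history_ind: h => [|h j IHh] le_d; first by rewrite history_loss_root subrr.
rewrite history_loss_extend endpoint_extend IHh => [|e eh]; last first.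
  by apply: le_d; rewrite arcs_of_extend in_setU1 eh orbT.
rewrite potential_lossE /=; first by rewrite addrC subrKA.
by apply: (le_d (last_arc j)); rewrite arcs_of_extend in_setU1 eqxx.
Qed.

Lemma potential_total_loss d (L : R) P :
  d source = 0 -> (forall x, sink edge x -> d x = L) ->
  (forall e, e \in arcs_of (val P) -> d (val e).1 <= d (val e).2) ->
  total_loss (potential_loss d) P = L.
Proof.
move=> d0 dL le_d; have := potential_loss_eq le_d.
by rewrite d0 subr0 (dL _ (valP P)).
Qed.

Lemma potential_efficient d (L : R) P :
  d source = 0 -> (forall x, sink edge x -> d x = L) ->
  (forall e, e \in arcs_of (val P) -> d (val e).1 <= d (val e).2) ->
  efficient (potential_loss d) P.
Proof.
move=> d0 dL le_d Q; rewrite (potential_total_loss d0 dL le_d).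
by have := potential_loss_ge d (val Q); rewrite d0 subr0 (dL _ (valP Q)).
Qed.

(** For [L >= 0] the corresponding losses are [L] on arcs into sinks and 0 elsewhere, so every path
    loses [L]. *)
Definition sink_potential (L : R) (x : G) : R := if sink edge x then L else 0.

(** Since ranks increase along [h], this says that [d] does not decrease along it, without indexing
    its nodes. *)
Definition rank_monotone d h :=
  {in nodes h &, forall x y, (rank x <= rank y)%N -> d x <= d y}.

Lemma potential_exists l h : exists d, [/\ d source = 0, rank_monotone d h &
  forall e, e \in arcs_of h -> (l e)%:num = d (val e).2 - d (val e).1].
Proof.
elim/history_ind: h => [|h j [d [d0 d_mono dE]]].
  exists (fun=> 0); split=> // e; by rewrite arcs_of_root inE.
have lt_j x : x \in nodes h -> (rank x < rank (val j))%N.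
  by move=> xh; exact: leq_ltn_trans (rank_endpoint xh) (rank_edge (valP j)).
have neq_j x : x \in nodes h -> (x == val j) = false.
  by move=> /lt_j xj; apply: contraTF xj => /eqP->; rewrite ltnn.
(* The potential of a node of the history is the loss accumulated on the way to it. *)
pose d' x := if x == val j then d (endpoint h) + (l (last_arc j))%:num else d x.
exists d'; split.
- by rewrite /d' neq_j // mem_head.
- move=> x y; rewrite !nodes_extend /d'.
  move=> /predU1P[->|xh] /predU1P[->|yh] //; rewrite ?eqxx ?neq_j //.
  + by rewrite leqNgt lt_j.
  + move=> _; apply: le_trans (d_mono _ _ xh (endpoint_nodes h) _) _.
      exact: rank_endpoint.
    by rewrite lerDl.
  + exact: d_mono.
move=> e; rewrite arcs_of_extend in_setU1 /d' => /predU1P[->|eh].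
  by rewrite /= eqxx neq_j ?endpoint_nodes // addrC addKr.
by have [e1 e2] := arc_nodes eh; rewrite !neq_j // dE.
Qed.

(* To erase the potential of an inner node [v] of [P], compare both potentials
   with a path [Q] avoiding [v]: extended off [P] by the largest potential of a
   node of [P], other than [v], of no larger rank, they make [P] and [Q]
   monotone, hence efficient, and charge [Q] the same losses. *)
Lemma erase_potential phi P d (L : R) (v : G) :
  efficient_implementation phi -> realized_loss_dependence phi ->
  pairwise_collusion_proof phi ->
  rank_monotone d (val P) -> d source = 0 -> d (endpoint (val P)) = L ->
  v \in nodes (val P) -> v != source -> ~~ sink edge v ->
  rank_monotone (fun x => if x == v then 0 else d x) (val P) ->
  phi P (potential_loss d) =
  phi P (potential_loss (fun x => if x == v then 0 else d x)).
Proof.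
move=> EI RLD PCP d_mono d0 dL vP vs nv d'_mono.
set d' := (fun x => _) in d'_mono *.
have [Q vQ] := path_avoiding vs nv.
(* Sinks carry [L], as [potential_efficient] asks. The default 0 of the maximum is harmless, since
   [d] is nonnegative on [P]. *)
pose pi (x : G) := if sink edge x then L else
  \big[Num.max/0]_(y | [&& y \in nodes (val P), y != v
                           & (rank y <= rank x)%N]) d y.
have sP : source \in nodes (val P) by rewrite mem_head.
have d_ge0 y : y \in nodes (val P) -> 0 <= d y.
  by move=> yP; rewrite -d0; apply: d_mono => //; exact: rank_source yP.
have d_leL y : y \in nodes (val P) -> d y <= L.
  move=> yP; rewrite -dL; apply: d_mono (rank_endpoint yP) => //.
  exact: endpoint_nodes.
have piP x : x \in nodes (val P) -> x != v -> pi x = d x.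
  move=> xP xv; rewrite /pi; case: ifP => [sx|_].
    by rewrite -dL (sink_endpoint xP sx).
  apply: le_anti; rewrite bigmax_le ?d_ge0 //=; last first.
    by move=> y /and3P[yP _ yx]; exact: d_mono.
  by rewrite le_bigmax_cond // xP xv leqnn.
have pi_mono x y : edge x y -> pi x <= pi y.
  move=> xy; rewrite /pi (negbTE (edge_nonsink xy)); case: ifP => _.
    apply: bigmax_le => [|z /and3P[/d_leL]//].
    by apply: le_trans (d_leL _ sP); exact: d_ge0.
  apply: sub_bigmax => z /and3P[-> -> zx] /=.
  exact: leq_trans zx (ltnW (rank_edge xy)).
(* The value [c] at [v] is [d v] before the erasure and 0 after it. [Q] avoids [v], so its losses do
   not depend on [c]. *)
pose bump (c : R) (x : G) := if x == v then c else pi x.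
have bump0 c : bump c source = 0.
  by rewrite /bump eq_sym (negbTE vs) piP // eq_sym.
have bumpL c x : sink edge x -> bump c x = L.
  by move=> sx; rewrite /bump ifN /pi ?sx //; apply: contraNneq nv => <-.
have bumpQ c : efficient (potential_loss (bump c)) Q.
  apply: potential_efficient (bump0 c) (bumpL c) _ => e /arc_nodes[e1 e2].
  by rewrite /bump !ifN ?pi_mono ?(valP e) //; apply: contraNneq vQ => <-.
have bumpP c (f : G -> R) : rank_monotone f (val P) ->
    {in nodes (val P), f =1 bump c} ->
    phi P (potential_loss f) = phi Q (potential_loss (bump c)).
  move=> f_mono fE.
  rewrite (RLD P _ _ (eq_potential_loss fE)).
  apply: efficient_liability => //.
  apply: potential_efficient (bump0 c) (bumpL c) _ => e /arc_nodes[e1 e2].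
  by rewrite -!fE //; apply: f_mono => //; exact/ltnW/rank_edge/(valP e).
rewrite (bumpP (d v) d) //; last first.
  by move=> x xP; rewrite /bump; case: eqVneq => [->//|xv]; rewrite piP.
rewrite (bumpP 0 d') //; last first.
  by move=> x xP; rewrite /bump /d'; case: eqVneq => [//|xv]; rewrite piP.
apply: RLD; apply: eq_potential_loss => x xQ.
by rewrite /bump ifN ?ifN //; apply: contraNneq vQ => <-.
Qed.

(** Erase the nonzero potentials of inner nodes one at a time, by increasing rank, until only that
    of the sink is left. *)
Lemma liability_sink_potential phi P d (L : R) :
  efficient_implementation phi -> realized_loss_dependence phi ->
  pairwise_collusion_proof phi ->
  rank_monotone d (val P) -> d source = 0 -> d (endpoint (val P)) = L ->
  phi P (potential_loss d) = phi P (potential_loss (sink_potential L)).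
Proof.
move=> EI RLD PCP.
pose A (f : G -> R) := finset (fun x : G =>
  [&& x \in nodes (val P), ~~ sink edge x & f x != 0]).
have [n] := ubnP #|A d|; elim: n d => // n IHn d; rewrite ltnS => An.
move=> d_mono d0 dL.
have [A0|[v0 v0A]] := set_0Vmem (A d).
  apply: RLD; apply: eq_potential_loss => x xP; rewrite /sink_potential.
  case: ifPn => [sx|nx]; first by rewrite -dL (sink_endpoint xP sx).
  by apply/eqP; have /setP/(_ x) := A0; rewrite in_set in_set0 xP nx => /negbFE.
(* As [v] has least rank, the nodes of [P] before it have potential 0, so erasing [v] preserves
   monotonicity. *)
have [v vA v_min] := arg_minnP (@rank G) v0A.
have : v \in A d := vA; rewrite in_set => /and3P[vP nv dv].
have vs : v != source by apply: contraNneq dv => ->; rewrite d0.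
have sP : source \in nodes (val P) by rewrite mem_head.
have d_ge0 y : y \in nodes (val P) -> 0 <= d y.
  by move=> yP; rewrite -d0; apply: d_mono => //; exact: rank_source yP.
have d'_mono : rank_monotone (fun x => if x == v then 0 else d x) (val P).
  move=> x y xP yP; case: (eqVneq x v) => [->|xv].
    by case: eqVneq => // _ _; exact: d_ge0.
  case: (eqVneq y v) => [->|_]; last exact: d_mono.
  move=> xv_rank; suff -> : d x = 0 by [].
  apply: contraNeq xv => dx; apply/eqP/(rank_inj xP vP)/eqP.
  rewrite eqn_leq xv_rank v_min //=.
  suff : x \in A d by []; rewrite in_set xP dx andbT /=.
  (* A sink on [P] is its endpoint, whose rank is at least that of [v]. This forces [x = v], but [v]
     is no sink. *)
  apply/negP => sx; have := rank_endpoint vP.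
  rewrite -(sink_endpoint xP sx) => vx.
  have /(rank_inj xP vP) xvE : rank x = rank v.
    by apply/eqP; rewrite eqn_leq xv_rank vx.
  by move: nv; rewrite -xvE sx.
rewrite (erase_potential EI RLD PCP d_mono d0 dL vP vs nv d'_mono).
apply: IHn d'_mono _ _.
- apply: leq_trans An; apply: proper_card; apply/properP; split.
    apply/subsetP => x; rewrite !in_set => /and3P[-> ->] /=.
    by case: ifP; rewrite ?eqxx.
  by exists v => //; rewrite in_set !eqxx !andbF.
- by rewrite eq_sym (negbTE vs).
- by rewrite ifN //; apply: contraNneq nv => <-; exact: (valP P).
Qed.

(** Erasure replaces [l] on [P] by the losses of the sink potential, for which all paths are
    efficient, so [Q] may replace [P]. *)
Lemma liability_total_loss phi P Q l :
  efficient_implementation phi -> realized_loss_dependence phi ->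
  pairwise_collusion_proof phi ->
  phi P l = phi Q (potential_loss (sink_potential (total_loss l P))).
Proof.
move=> EI RLD PCP; have [d [d0 d_mono dE]] := potential_exists l (val P).
have d_arc e : e \in arcs_of (val P) -> d (val e).1 <= d (val e).2.
  move=> /arc_nodes[e1 e2]; apply: d_mono => //.
  exact/ltnW/rank_edge/(valP e).
have lE e : e \in arcs_of (val P) -> l e = potential_loss d e.
  by move=> eP; apply: val_inj; rewrite /= potential_lossE ?d_arc // -dE.
have dL : d (endpoint (val P)) = total_loss l P.
  rewrite (eq_total_loss lE) [RHS](potential_loss_eq d_arc).
  by rewrite d0 subr0.
rewrite (RLD P _ _ lE) (liability_sink_potential EI RLD PCP d_mono d0 dL).
have eff S : efficient (potential_loss (sink_potential (total_loss l P))) S.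
  apply: (@potential_efficient _ (total_loss l P)) => [|x|e _].
  - rewrite /sink_potential; case: ifP => // ss.
    by rewrite -dL -(sink_endpoint (mem_head _ _) ss).
  - by rewrite /sink_potential => ->.
  - rewrite /sink_potential (negbTE (edge_nonsink (valP e))).
    by case: ifP => // _; apply: sumr_ge0.
exact: efficient_liability.
Qed.

End Losses.

(** * Fixed-weight rules *)

Section Rules.
Variables (R : realType) (G : network).
Implicit Types (h k : history G) (P Q : full_path G) (l : loss R G).
Implicit Types (sigma : profile G) (phi : rule R G) (w : {ffun G -> R}).

Lemma total_loss_ge0 l P : 0 <= total_loss l P.
Proof. exact: sumr_ge0. Qed.

Lemma total_loss_scale (a : {posnum R}) l P :
  total_loss (scale a l) P = a%:num * total_loss l P.
Proof. by rewrite mulr_sumr; apply: eq_bigr => e _; rewrite ffunE. Qed.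

Lemma sink_potential_scale (a : {posnum R}) :
  potential_loss (@sink_potential R G a%:num) =
  scale a (potential_loss (sink_potential 1)).
Proof.
apply/ffunP => e; apply: val_inj; rewrite !ffunE /= /sink_potential.
rewrite (negbTE (edge_nonsink (valP e))) !subr0.
by case: ifP => _; rewrite ?normr1 ?normr0 ?mulr1 ?mulr0 // ger0_norm.
Qed.

(** Otherwise every history would be trivial and the source the only node. *)
Lemma source_nonsink : ~~ sink edge (@source G).
Proof.
apply/negP => ss; have /card_gt1P[x [y [_ _]]] : (1 < #|G|)%N.
  exact: leq_trans (card_node G).
have all_source (z : G) : z = source.
  have [h <-] := history_to z.
  by apply/esym; apply: sink_endpoint ss; rewrite mem_head.
by rewrite (all_source x) (all_source y) eqxx.
Qed.

Lemma sink_potential_total_loss P :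
  total_loss (potential_loss (sink_potential 1)) P = 1 :> R.
Proof.
apply: potential_total_loss => [|x|e _]; rewrite /sink_potential.
- by rewrite (negbTE source_nonsink).
- by move=> ->.
- by rewrite (negbTE (edge_nonsink (valP e))); case: ifP.
Qed.

(** * Necessity: the weights and their positivity *)

Lemma fixed_weight_of_axioms phi :
  efficient_implementation phi -> realized_loss_dependence phi ->
  pairwise_collusion_proof phi -> scale_invariant phi ->
  exists2 w, simplex w & liability phi =2 fixed_weight w.
Proof.
move=> EI RLD PCP SI; have [sigma _] := profile_exists G.
pose P0 := outcome sigma.
(* The weights are the liabilities at a total loss of 1; the path [P0] is arbitrary. *)
exists (phi P0 (potential_loss (sink_potential 1))).
  split=> [i|]; first exact: liability_ge0.
  by rewrite liability_sum sink_potential_total_loss.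
move=> P l; apply/ffunP => i; rewrite ffunE.
(* Scaling by a positive factor does not reach a total loss of 0, but there nonnegative liabilities
   sum to 0. *)
have := total_loss_ge0 l P; rewrite le_eqVlt => /predU1P[l0|l_gt0].
  rewrite -l0 mulr0; have /eqP := liability_sum phi P l.
  rewrite -l0 psumr_eq0 => [/allP/(_ i)|j _]; last exact: liability_ge0.
  by rewrite mem_index_enum => /(_ isT)/eqP.
rewrite (liability_total_loss P P0 l EI RLD PCP) mulrC.
by rewrite (sink_potential_scale (PosNum l_gt0)) SI.
Qed.

(** With weight 0 the agent at [h] is indifferent, so some equilibrium picks [y] there. Yet zero
    losses with a surcharge make only the paths through [h] and then [x] efficient. *)
Lemma fixed_weight_gt0 phi w :
  efficient_implementation phi -> liability phi =2 fixed_weight w ->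
  (forall i, 0 <= w i) -> forall i, (1 < #|out edge i|)%N -> 0 < w i.
Proof.
move=> EI phiE w_ge0 i /card_gt1P[x [y []]]; rewrite !in_set.
have [h <-] := history_to i => hx hy neq_xy.
rewrite lt_neqAle w_ge0 andbT eq_sym; apply/negP => /eqP wi0.
pose a : {j | edge (endpoint h) j} := exist (fun j => is_true (edge _ j)) x hx.
have [l [l_in l_out]] := surcharge ([ffun=> 0%:nng] : loss R G) (extend a).
pose move g := if g == h then Some y else None.
have moveE g j : move g = Some j -> edge (endpoint g) j.
  by rewrite /move; case: eqP => // -> [<-].
have [sigma sigmaP] := backward_induction (fun i P => phi P l i) moveE.
have eqs : equilibrium phi l sigma.
  apply/equilibriumP => g ng j; have := sigmaP g ng; rewrite /move.
  case: eqP => [eq_gh _|_]; last exact.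
  by move: j; rewrite eq_gh => j; rewrite !phiE !ffunE wi0 !mul0r.
have effs : efficient l (outcome sigma) by rewrite -(EI l); exists sigma.
have total0 P : total_loss ([ffun=> 0%:nng] : loss R G) P = 0.
  by apply: big1 => e _; rewrite ffunE.
have throughs : through (extend a) (val (outcome sigma)).
  apply/negPn/negP => /l_out; apply/negP; rewrite -ltNge total0 add0r.
  apply: le_lt_trans (effs (play sigma (extend a))) _.
  by rewrite (eq_total_loss (l_in _ (play_through _ _))) total0.
have hs := through_trans (through_extend a) throughs.
have nh := edge_nonsink hx.
have := play_through sigma (extend (next sigma nh)).
rewrite -play_next (play_on_path (through_root h) hs).
move=> /(through_next_uniq throughs) aE.
have := sigmaP h nh; rewrite /move eqxx -aE => eq_xy.
by move: neq_xy; rewrite -[x]/(val a) eq_xy eqxx.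
Qed.

(** * Sufficiency: the axioms for fixed-weight rules *)

Section FixedWeight.
Variables (phi : rule R G) (w : {ffun G -> R}).
Hypotheses (w_star : simplex_star w) (phiE : liability phi =2 fixed_weight w).

Let w_ge0 i : 0 <= w i.
Proof. by case: w_star => -[]. Qed.

Let phi_le P Q l i :
  total_loss l P <= total_loss l Q -> phi P l i <= phi Q l i.
Proof. by move=> le_PQ; rewrite !phiE !ffunE ler_wpM2l. Qed.

(** Where there is a choice the weight is positive, so the mover minimizes the total loss; elsewhere
    the move is forced. *)
Lemma fixed_weight_equilibrium l sigma h Q : equilibrium phi l sigma ->
  through h (val Q) -> total_loss l (play sigma h) <= total_loss l Q.
Proof.
move=> /equilibriumP eqs; elim/history_coind: h => h IHh hQ.
have [sh|nh] := boolP (sink edge (endpoint h)).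
  rewrite (_ : play sigma h = Q) //; apply: val_inj.
  by rewrite play_sink // (through_sink hQ sh).
have [j jQ] := through_next hQ nh; apply: le_trans (IHh j jQ).
have [out1|out2] := leqP #|out edge (endpoint h)| 1.
  rewrite (play_next _ nh) (_ : next sigma nh = j) //; apply: val_inj.
  by apply: (card_le1_eqP out1); rewrite in_set; exact: valP.
have wh : 0 < w (endpoint h) by case: w_star => _; exact.
by have := eqs h nh j; rewrite !phiE !ffunE ler_pM2l.
Qed.

Lemma fixed_weight_efficient_implementation : efficient_implementation phi.
Proof.
move=> l; apply/classical_sets.seteqP; split=> [_ [sigma eqs <-] Q|P effP].
  exact: fixed_weight_equilibrium (through_root _).
(* Stay on [P] while on it and be optimal elsewhere. As [P] is efficient, leaving it lowers no
   liability. *)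
pose move h : option G :=
  omap val [pick j : {j | edge (endpoint h) j} | through (extend j) (val P)].
have moveE h j : move h = Some j -> edge (endpoint h) j.
  by rewrite /move; case: pickP => //= a _ [<-]; exact: valP.
have [sigma sigmaP] := backward_induction (fun i Q => phi Q l i) moveE.
have playP h : through h (val P) -> play sigma h = P.
  elim/history_coind: h => h IHh hP.
  have [sh|nh] := boolP (sink edge (endpoint h)).
    by apply: val_inj; rewrite play_sink // (through_sink hP sh).
  rewrite (play_next _ nh); apply: IHh.
  have := sigmaP h nh; rewrite /move; case: pickP => [a aP /val_inj-> //|noP _].
  by have [j] := through_next hP nh; rewrite noP.
exists sigma; last exact/playP/through_root.
apply/equilibriumP => h nh j; have := sigmaP h nh; rewrite /move.
case: pickP => [a aP _|_]; last exact.
rewrite playP; first exact/phi_le/effP.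
exact: through_trans (through_extend a) aP.
Qed.

Lemma fixed_weight_axioms :
  [/\ efficient_implementation phi, realized_loss_dependence phi,
      pairwise_collusion_proof phi & scale_invariant phi].
Proof.
split.
- exact: fixed_weight_efficient_implementation.
- move=> P l l' eq_l; apply/ffunP => i.
  by rewrite !phiE !ffunE (eq_total_loss eq_l).
(* Equilibrium paths are efficient, and no liability falls when the total loss grows. *)
- move=> l sigma eqs i tau j /=.
  by apply: lerD; apply: phi_le;
    exact: fixed_weight_equilibrium eqs (through_root _).
- by move=> P l a i; rewrite !phiE !ffunE total_loss_scale mulrCA.
Qed.

End FixedWeight.

End Rules.

Theorem theorem1 (R : realType) (G : network) (phi : rule R G) :
  [/\ efficient_implementation phi, realized_loss_dependence phi,
      pairwise_collusion_proof phi & scale_invariant phi] <->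
  exists2 w : {ffun G -> R}, simplex_star w & liability phi =2 fixed_weight w.
Proof.
split=> [[EI RLD PCP SI]|[w w_star phiE]]; last exact: fixed_weight_axioms phiE.
have [w w_simplex phiE] := fixed_weight_of_axioms EI RLD PCP SI.
exists w => //; split=> //; case: w_simplex => w_ge0 _.
exact: fixed_weight_gt0 EI phiE w_ge0.
Qed.
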